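(* Let $\Omega$ be a topological space, $T_1,\dots,T_\gamma$ commuting homeomorphisms of $\Omega$, $T^n=T_1^{n_1}\cdots T_\gamma^{n_\gamma}$, $\mu$ a Borel measure on $\Omega$ ergodic for this $\mathbb{Z}^\gamma$-action, $f:\Omega\to\mathbb{R}$ continuous, and $(H_\omega u)(n)=\sum_{|m-n|=1}u(m)+f(T^n\omega)u(n)$ on $\ell^2(\mathbb{Z}^\gamma)$. If $H_\omega$ has uniformly localized eigenfunctions (ULE) for $\mu$-a.e. $\omega\in\Omega$, then there exists $\alpha>0$ independent of $\omega$ such that for $\mu$-a.e. $\omega$ there is a constant $C_\omega>0$, a complete orthonormal set of eigenfunctions $\{\phi^\omega_n\}$ of $H_\omega$ and points $m^\omega_n\in\mathbb{Z}^\gamma$ with $|\phi_n^\omega(m)|\le C_\omega e^{-\alpha|m-m_n^\omega|}$ for all $n$ and $m$.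
   Context: A self-adjoint operator $H$ on $\ell^2(\mathbb{Z}^\gamma)$ has ULE if it has a complete orthonormal set of eigenfunctions $\{\phi_n\}$ and there exist $\alpha>0$, $C>0$ and points $m_n\in\mathbb{Z}^\gamma$ such that $|\phi_n(m)|\le Ce^{-\alpha|m-m_n|}$ for all $n,m$. *)

(* Defs.v *)
From HB Require Import structures.
From mathcomp Require Import all_boot all_order all_algebra.
From mathcomp Require Import all_classical all_reals all_analysis.
From mathcomp.real_closed Require Import complex.

Set Implicit Arguments.
Unset Strict Implicit.
Unset Printing Implicit Defensive.

Import Order.TTheory GRing.Theory Num.Theory.
Import numFieldNormedType.Exports.
Import ComplexField.

Local Open Scope classical_set_scope.
Local Open Scope ring_scope.
Local Open Scope complex_scope.

Definition Zg (g : nat) := 'rV[int]_g.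

Definition l1norm (R : realType) (g : nat) (m : Zg g) : R :=
  \sum_(i < g) (`|m ord0 i|%:~R : R).

Definition unitv (g : nat) (i : 'I_g) : Zg g := delta_mx ord0 i.

Definition cmod (R : realType) (z : R[i]) : R := Num.sqrt (complex.Re z ^+ 2 + complex.Im z ^+ 2).

Definition boxsum (V : nmodType) (g : nat) (N : nat) (F : Zg g -> V) : V :=
  \sum_(k : {ffun 'I_g -> 'I_(2 * N + 1)})
     F (\row_(i < g) ((k i : nat)%:Z - N%:Z)).

Definition l2 (R : realType) (g : nat) (u : Zg g -> R[i]) : Prop :=
  exists M : R, forall N : nat, boxsum N (fun m => cmod (u m) ^+ 2) <= M.

Definition ccvg (R : realType) (S : nat -> R[i]) (c : R[i]) : Prop :=
  (fun N : nat => cmod (S N - c)) @ \oo --> (0 : R).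

Definition inner_is (R : realType) (g : nat) (u v : Zg g -> R[i]) (c : R[i]) : Prop :=
  ccvg (fun N => boxsum N (fun m => u m * conjc (v m))) c.

Definition complete_orthonormal (R : realType) (g : nat) (I : Type)
    (phi : I -> Zg g -> R[i]) : Prop :=
  [/\ forall i, l2 (phi i),
      forall i, inner_is (phi i) (phi i) 1,
      forall i j, i <> j -> inner_is (phi i) (phi j) 0 &
      forall psi, l2 psi -> (forall i, inner_is psi (phi i) 0) -> psi = (fun _ => 0)].

Definition eigenfunction (R : realType) (g : nat)
    (H : (Zg g -> R[i]) -> Zg g -> R[i]) (phi : Zg g -> R[i]) : Prop :=
  [/\ l2 phi, phi <> (fun _ => 0) &
      exists E : R[i], forall n, H phi n = E * phi n].

Definition ULE_with (R : realType) (g : nat) (alpha : R)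
    (H : (Zg g -> R[i]) -> Zg g -> R[i]) : Prop :=
  exists C : R, 0 < C /\
  exists (I : Type) (phi : I -> Zg g -> R[i]) (mpt : I -> Zg g),
    [/\ complete_orthonormal phi,
        forall n, eigenfunction H (phi n) &
        forall n m, cmod (phi n m) <= C * expR (- alpha * l1norm R (m - mpt n))].

Definition ULE (R : realType) (g : nat) (H : (Zg g -> R[i]) -> Zg g -> R[i]) : Prop :=
  exists alpha : R, 0 < alpha /\ ULE_with alpha H.

Definition schrod (R : realType) (g : nat) (V : Zg g -> R) (u : Zg g -> R[i])
    (n : Zg g) : R[i] :=
  \sum_(i < g) (u (n + unitv i) + u (n - unitv i)) + (V n)%:C * u n.

Definition titer (X : Type) (T Tinv : X -> X) (z : int) : X -> X :=
  match z with
  | Posz k => iter k T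
  | Negz k => iter k.+1 Tinv
  end.

Definition Tpow (X : Type) (g : nat) (T Tinv : 'I_g -> X -> X) (n : Zg g) : X -> X :=
  foldr (fun i h => titer (T i) (Tinv i) (n ord0 i) \o h) id (enum 'I_g).

Definition ergodic (R : realType) (d : measure_display) (X : measurableType d)
    (g : nat) (mu : {measure set X -> \bar R}) (T : 'I_g -> X -> X) : Prop :=
  (forall i A, measurable A -> mu (T i @^-1` A) = mu A) /\
  (forall A, measurable A -> (forall i, T i @^-1` A = A) ->
     mu A = 0%E \/ mu (~` A) = 0%E).

(* Main.v *)
Require Import Defs.
From HB Require Import structures.
From mathcomp Require Import all_boot all_order all_algebra.
From mathcomp Require Import all_classical all_reals all_analysis.
From mathcomp.real_closed Require Import complex.
From mathcomp Require Import ring lra zify.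
Import Order.TTheory GRing.Theory Num.Theory.
Import numFieldNormedType.Exports.
Import ComplexField Normc.
Local Open Scope classical_set_scope.
Local Open Scope ring_scope.

(* For fixed [a] and [C] the set of potentials admitting an eigenbasis with decay
   [C exp (- a |m - m_n|)] is closed under pointwise limits.  By Bessel's inequality
   at most [(C W)^2] eigenfunctions share a localization center, [W] being a bound for
   the sums of [exp (- a |m - x|)] over [m], so the basis can be indexed by centers and
   boundedly many slots; every function is then dominated independently of the
   potential, and orthonormality, the eigenvalue equation and the resolution of the
   identity all pass to the limit along an ultrafilter.  Hence
   [{w | H_w has decay (a, C)}] is closed in [Omega], so its union over [C] is Borel; that
   union is invariant under the action, and the unions over [C] for [a = 1 / (k + 1)]
   exhaust almost every [w], so by ergodicity one of them has a null complement. *)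

Set Implicit Arguments.
Unset Strict Implicit.
Unset Printing Implicit Defensive.

(** * Modulus and limits of complex-valued functions along a filter *)

Section ComplexLimits.
Variable R : realType.
Implicit Types (x y z c : R[i]).

Lemma cmodE z : cmod z = normc z.
Proof. by case: z. Qed.

Lemma cmod_ge0 z : 0 <= cmod z.
Proof. exact: sqrtr_ge0. Qed.

Lemma cmod0 : cmod (0 : R[i]) = 0.
Proof. by rewrite cmodE normc0. Qed.

Lemma cmod1 : cmod (1 : R[i]) = 1.
Proof. by rewrite cmodE normc1. Qed.

Lemma cmodD x y : cmod (x + y) <= cmod x + cmod y.
Proof. by rewrite !cmodE; exact: le_normcD. Qed.

Lemma cmodN z : cmod (- z) = cmod z.
Proof. by rewrite !cmodE normcN. Qed.

Lemma cmodM x y : cmod (x * y) = cmod x * cmod y.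
Proof. by rewrite !cmodE normcM. Qed.

Lemma cmodJ z : cmod (conjc z) = cmod z.
Proof. by case: z => a b; rewrite /cmod /= sqrrN. Qed.

Lemma cmodJM z : z * conjc z = (cmod z ^+ 2)%:C%C.
Proof.
case: z => a b; rewrite /cmod sqr_sqrtr ?addr_ge0 ?sqr_ge0 //=.
by apply/eqP; rewrite eq_complex /=; apply/andP; split; apply/eqP; ring.
Qed.

Lemma cmod_real (r : R) : cmod r%:C%C = `|r|.
Proof. by rewrite /cmod /= expr0n addr0 sqrtr_sqr. Qed.

Lemma cmod_sum (I : Type) (s : seq I) (P : pred I) (F : I -> R[i]) :
  cmod (\sum_(i <- s | P i) F i) <= \sum_(i <- s | P i) cmod (F i).
Proof.
elim/big_ind2 : _ => [|x1 x2 y1 y2 h1 h2|//]; first by rewrite cmod0.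
by rewrite (le_trans (cmodD _ _)) // lerD.
Qed.

Lemma Re_cmod z : `|complex.Re z| <= cmod z.
Proof.
by rewrite -sqrtr_sqr ler_wsqrtr // lerDl sqr_ge0.
Qed.

Lemma Im_cmod z : `|complex.Im z| <= cmod z.
Proof.
by rewrite -sqrtr_sqr ler_wsqrtr // lerDr sqr_ge0.
Qed.

Lemma cmod_ReIm z : cmod z <= `|complex.Re z| + `|complex.Im z|.
Proof.
rewrite -(@ger0_norm _ (_ + `|complex.Im z|)) ?addr_ge0 //.
rewrite -sqrtr_sqr ler_wsqrtr // sqrrD !real_normK ?num_real //.
by rewrite addrAC lerDl mulrn_wge0 // mulr_ge0.
Qed.

Lemma ReD x y : complex.Re (x + y) = complex.Re x + complex.Re y.
Proof. by case: x y => ? ? []. Qed.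

Lemma ImD x y : complex.Im (x + y) = complex.Im x + complex.Im y.
Proof. by case: x y => ? ? []. Qed.

Lemma ReB x y : complex.Re (x - y) = complex.Re x - complex.Re y.
Proof. by case: x y => ? ? []. Qed.

Lemma ImB x y : complex.Im (x - y) = complex.Im x - complex.Im y.
Proof. by case: x y => ? ? []. Qed.

Lemma ReM x y : complex.Re (x * y) =
  complex.Re x * complex.Re y - complex.Im x * complex.Im y.
Proof. by case: x y => ? ? []. Qed.

Lemma ImM x y : complex.Im (x * y) =
  complex.Re x * complex.Im y + complex.Im x * complex.Re y.
Proof. by case: x y => ? ? []. Qed.

(** For the filter [\oo] this is convertible to [ccvg], so that the lemmas on [ctends] apply
    directly to [inner_is]. *)
Definition ctends (T : Type) (F : set_system T) (h : T -> R[i]) c :=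
  (fun t => cmod (h t - c)) @ F --> (0 : R).

Context {T : Type} {F : set_system T} {FF : ProperFilter F}.
Implicit Types (h k : T -> R[i]).

Lemma ctendsP h c :
  ctends F h c <-> forall e, 0 < e -> \forall t \near F, cmod (h t - c) < e.
Proof.
split=> [hc e e0|H].
  move/cvgrPdist_lt : hc => /(_ e e0); apply: filterS => t /=.
  by rewrite sub0r normrN ger0_norm ?cmod_ge0.
apply/cvgrPdist_lt => e /H; apply: filterS => t /=.
by rewrite sub0r normrN ger0_norm ?cmod_ge0.
Qed.

Lemma ctends_squeeze h c (b : T -> R) :
  (\forall t \near F, cmod (h t - c) <= b t) -> b @ F --> (0 : R) ->
  ctends F h c.
Proof.
move=> hb b0; apply: (squeeze_cvgr _ _ b0); last exact: (cvg_cst (0 : R)).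
by apply: filterS hb => t ->; rewrite cmod_ge0.
Qed.

Lemma ctends_ReIm h c : ctends F h c <->
  (fun t => complex.Re (h t)) @ F --> complex.Re c /\
  (fun t => complex.Im (h t)) @ F --> complex.Im c.
Proof.
split=> [/ctendsP H|[hr hi]].
  split; apply/cvgrPdist_lt => e /H; apply: filterS => t;
    apply: le_lt_trans; rewrite -normrN opprB.
  - by have := Re_cmod (h t - c); rewrite ReB.
  - by have := Im_cmod (h t - c); rewrite ImB.
apply: (@ctends_squeeze _ _ (fun t => `|complex.Re (h t) - complex.Re c| +
   `|complex.Im (h t) - complex.Im c|)).
  apply: nearW => t; by rewrite (le_trans (cmod_ReIm _))// ReB ImB.
rewrite -(addr0 0); apply: cvgD; apply/cvgr0Pnorm_lt => e e0.
- move/cvgrPdist_lt : hr => /(_ e e0); apply: filterS => t.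
  by rewrite normr_id -normrN opprB.
- move/cvgrPdist_lt : hi => /(_ e e0); apply: filterS => t.
  by rewrite normr_id -normrN opprB.
Qed.

Lemma ctends_cst c : ctends F (fun=> c) c.
Proof. by apply/ctends_ReIm; split; exact: cvg_cst. Qed.

Lemma ctendsD h k c d : ctends F h c -> ctends F k d ->
  ctends F (fun t => h t + k t) (c + d).
Proof.
move=> /ctends_ReIm[h1 h2] /ctends_ReIm[k1 k2]; apply/ctends_ReIm.
rewrite ReD ImD; split.
  by under eq_fun do rewrite ReD; exact: cvgD.
by under eq_fun do rewrite ImD; exact: cvgD.
Qed.

Lemma ctendsM h k c d : ctends F h c -> ctends F k d ->
  ctends F (fun t => h t * k t) (c * d).
Proof.
move=> /ctends_ReIm[h1 h2] /ctends_ReIm[k1 k2]; apply/ctends_ReIm.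
rewrite ReM ImM; split.
  by under eq_fun do rewrite ReM; apply: cvgB; exact: cvgM.
by under eq_fun do rewrite ImM; apply: cvgD; exact: cvgM.
Qed.

Lemma ctendsJ h c : ctends F h c -> ctends F (fun t => conjc (h t)) (conjc c).
Proof.
by rewrite /ctends; under eq_fun do rewrite -cmodJ rmorphB.
Qed.

Lemma ctends_sum (I : Type) (s : seq I) (P : pred I) (h : I -> T -> R[i]) (c : I -> R[i]) :
  (forall i, ctends F (h i) (c i)) ->
  ctends F (fun t => \sum_(i <- s | P i) h i t) (\sum_(i <- s | P i) c i).
Proof.
move=> hc; elim: s => [|i s ih].
  by under eq_fun do rewrite big_nil; rewrite big_nil; exact: ctends_cst.
under eq_fun do rewrite big_cons; rewrite big_cons; case: (P i) => //.
exact: ctendsD.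
Qed.

Lemma ctends_near h k c : (\forall t \near F, h t = k t) ->
  ctends F h c -> ctends F k c.
Proof.
move=> hk /ctendsP H; apply/ctendsP => e /H H1.
by apply: filterS2 hk H1 => t ->.
Qed.

Lemma ctends_unique h c d : ctends F h c -> ctends F h d -> c = d.
Proof.
move=> /ctends_ReIm[h1 h2] /ctends_ReIm[k1 k2].
have := cvg_unique _ h1 k1; have := cvg_unique _ h2 k2.
by case: c d {h1 h2 k1 k2} => ? ? [? ?] /= -> // ->.
Qed.

Lemma ctends_le h c (M : R) : (\forall t \near F, cmod (h t) <= M) ->
  ctends F h c -> cmod c <= M.
Proof.
move=> hM /ctendsP hc; apply/ler_addgt0Pr => e /hc hce.
have [t [h1 h2]] := filter_ex (filterI hM hce).
rewrite -(subrK (h t) c) addrC (le_trans (cmodD _ _))// lerD //.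
by rewrite -cmodN opprB ltW.
Qed.

End ComplexLimits.

(** The image of an ultrafilter is an ultrafilter, and it contains the compact segment [[- M, M]],
    hence converges there. This is applied to the real and imaginary parts. *)
Lemma ultra_ctends (R : realType) (T : Type) (F : set_system T) (h : T -> R[i]) (M : R) :
  UltraFilter F -> (\forall t \near F, cmod (h t) <= M) ->
  exists c, ctends F h c.
Proof.
move=> UF hM.
have real_lim (k : T -> R) : (\forall t \near F, `|k t| <= M) ->
    exists a : R, k @ F --> a.
  move=> kM; have := @segment_compact R (- M) M; rewrite compact_ultra.
  have UkF : UltraFilter (k @ F).
    split=> [|G FG kFG]; first exact: fmap_proper_filter.
    apply/seteqP; split => A; last exact: kFG.
    move=> GA; case: (in_ultra_setVsetC (k @^-1` A) UF) => // FA.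
    have /filter_ex[x []]// : G (A `&` ~` A).
    by apply: filterI => //; apply: kFG.
  move=> /(_ _ UkF) [|a [_ ka]]; last by exists a.
  by apply: filterS kM => t; rewrite /= in_itv /= ler_norml.
have [a ha] := real_lim (fun t => complex.Re (h t))
  (filterS (fun t H => le_trans (Re_cmod (h t)) H) hM).
have [b hb] := real_lim (fun t => complex.Im (h t))
  (filterS (fun t H => le_trans (Im_cmod (h t)) H) hM).
by exists (Complex a b); apply/ctends_ReIm.
Qed.

(** * Sums over the lattice as limits of box sums: domination, Fubini, translation *)

Section BoxSums.
Variables (g : nat).
Implicit Types (N n : nat).

Definition boxseq N : seq (Zg g) :=
  [seq \row_(i < g) ((k i : nat)%:Z - N%:Z) |
     k : {ffun 'I_g -> 'I_(2 * N + 1)} <- enum {: {ffun 'I_g -> 'I_(2 * N + 1)}}].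

Lemma boxsumE (V : nmodType) N (F : Zg g -> V) :
  boxsum N F = \sum_(m <- boxseq N) F m.
Proof. by rewrite big_map big_enum. Qed.

Lemma boxseq_uniq N : uniq (boxseq N).
Proof.
rewrite map_inj_uniq ?enum_uniq // => k1 k2 /rowP k12; apply/ffunP => i.
by have := k12 i; rewrite !mxE => /addIr [] /val_inj.
Qed.

Lemma mem_boxseq N m : (m \in boxseq N) = [forall i, (`|m ord0 i|%N <= N)%N].
Proof.
apply/mapP/forallP => [[k _ ->] i|H].
  have Hlt (j : nat) : (j < 2 * N + 1)%N -> (absz (j%:Z - N%:Z)%R <= N)%N by lia.
  by rewrite mxE; apply: Hlt.
have Hlt i : (absz (m ord0 i + N%:Z)%R < 2 * N + 1)%N by have := H i; lia.
exists [ffun i => Ordinal (Hlt i)]; first by rewrite mem_enum.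
apply/rowP => i; rewrite mxE ffunE /=.
have Hz (z : int) : (`|z| <= N)%N -> z = (absz (z + N%:Z)%R)%:Z - N%:Z by lia.
exact: (Hz _ (H i)).
Qed.

Lemma sum_subset (V : nmodType) (s t : seq (Zg g)) (F : Zg g -> V) :
  uniq s -> uniq t -> {subset s <= t} ->
  \sum_(m <- t) F m = \sum_(m <- s) F m + \sum_(m <- t | m \notin s) F m.
Proof.
move=> us ut st; rewrite (bigID (mem s)) /=; congr (_ + _).
rewrite -big_filter; apply: perm_big; apply: uniq_perm => //.
  by rewrite filter_uniq.
by move=> m; rewrite mem_filter; case ms: (m \in s); rewrite //= st.
Qed.

Lemma boxseq_sub n N : (n <= N)%N -> {subset boxseq n <= boxseq N}.
Proof.
move=> nN m; rewrite !mem_boxseq => /forallP H; apply/forallP => i.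
exact: leq_trans (H i) nN.
Qed.

Lemma boxseq_ex (x : Zg g) : exists r, x \in boxseq r.
Proof.
exists (\max_(i < g) `|x ord0 i|%N); rewrite mem_boxseq; apply/forallP => i.
exact: (leq_bigmax i).
Qed.

Variable R : realType.
Implicit Types (F : Zg g -> R[i]) (M : Zg g -> R).

(** The difference is a sum over points of the large box outside the small one. Leaving [s]
    arbitrary between the boxes covers translated boxes too. *)
Lemma sum_boxsum_dist F M (s : seq (Zg g)) n N :
  (forall m, cmod (F m) <= M m) ->
  uniq s -> {subset boxseq n <= s} -> {subset s <= boxseq N} ->
  cmod (\sum_(m <- s) F m - boxsum n F) <= boxsum N M - boxsum n M.
Proof.
move=> FM us ns sN; rewrite !boxsumE (sum_subset _ (boxseq_uniq n) us ns).
rewrite addrAC subrr add0r (sum_subset _ (boxseq_uniq n) (boxseq_uniq N)); last first.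
  by move=> m /ns/sN.
rewrite addrAC subrr add0r (le_trans (cmod_sum _ _ _))//.
apply: (@le_trans _ _ (\sum_(m <- s | m \notin boxseq n) M m)).
  by apply: ler_sum => m _; exact: FM.
rewrite -!(big_filter _ (fun m => m \notin boxseq n)).
rewrite (@sum_subset _ [seq x <- s | x \notin boxseq n]
  [seq x <- boxseq N | x \notin boxseq n]).
- by rewrite lerDl sumr_ge0 // => m _; rewrite (le_trans (cmod_ge0 _) (FM m)).
- by rewrite filter_uniq.
- by rewrite filter_uniq // boxseq_uniq.
- by move=> m; rewrite !mem_filter => /andP[-> /sN].
Qed.

Definition bsummable M := (forall m, 0 <= M m) /\ exists B, forall N, boxsum N M <= B.

(** Box sums of a nonnegative function increase, so bounded ones converge; [tau n] is the distance
    from the [n]-th one to the limit. *)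
Lemma bsummable_tail M : bsummable M ->
  exists tau : nat -> R, tau @ \oo --> (0 : R) /\
    forall n N, boxsum N M - boxsum n M <= tau n.
Proof.
move=> [M0 [B MB]]; pose S n := boxsum n M.
have Snd : nondecreasing_seq S.
  move=> n N nN; rewrite /S !boxsumE.
  rewrite (sum_subset _ (boxseq_uniq n) (boxseq_uniq N) (boxseq_sub nN)).
  by rewrite lerDl sumr_ge0.
have Scvg : cvgn S.
  by apply: nondecreasing_is_cvgn => //; exists B => _ [n _ <-]; exact: MB.
exists (fun n => limn S - S n); split; last first.
  by move=> n N; rewrite lerD2r; exact: nondecreasing_cvgn_le.
by rewrite -(subrr (limn S)); apply: cvgB => //; exact: cvg_cst.
Qed.

Lemma boxsum_tail F M tau : (forall m, cmod (F m) <= M m) ->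
  (forall n N, boxsum N M - boxsum n M <= tau n) ->
  forall n N, (n <= N)%N -> cmod (boxsum N F - boxsum n F) <= tau n.
Proof.
move=> FM Mtau n N nN; rewrite [boxsum N F]boxsumE.
apply: le_trans (Mtau n N); apply: sum_boxsum_dist => //.
  exact: boxseq_uniq.
exact: boxseq_sub.
Qed.

(** Dominated convergence along any proper filter. The tail bound [tau n] on the distance from
    [boxsum n (h t)] to [c t] does not depend on [t], so it survives the limit along [G] and bounds
    the distance from [boxsum n l] to [sigma]. *)
Lemma dominated_ctends (T : Type) (G : set_system T) (GF : ProperFilter G)
    (h : T -> Zg g -> R[i]) (l : Zg g -> R[i]) M (c : T -> R[i]) (sigma : R[i]) :
  bsummable M ->
  (\forall t \near G, forall m, cmod (h t m) <= M m) ->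
  (forall m, ctends G (fun t => h t m) (l m)) ->
  (\forall t \near G, ctends \oo (fun N => boxsum N (h t)) (c t)) ->
  ctends G c sigma ->
  ctends \oo (fun N => boxsum N l) sigma.
Proof.
move=> /bsummable_tail [tau [tau0 Mtau]] hM hl hc csigma.
apply: (ctends_squeeze _ tau0); apply: nearW => n.
apply: (@ctends_le _ _ G _ (fun t => boxsum n (h t) - c t)); last first.
  apply: ctendsD; first by apply: ctends_sum => k; exact: hl.
  rewrite -mulN1r; under eq_fun do rewrite -mulN1r.
  by apply: ctendsM => //; exact: ctends_cst.
apply: filterS2 hM hc => t htM htc; rewrite -cmodN opprB.
apply: (@ctends_le _ _ \oo _ (fun N => boxsum N (h t) - boxsum n (h t))).
  by exists n => // N /= nN; exact: (boxsum_tail htM).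
by apply: ctendsD => //; exact: ctends_cst.
Qed.

(** The bounded box sums have a limit along an ultrafilter finer than [\oo]; the tail estimate shows
    that it is the limit along [\oo] itself. *)
Lemma bsum_ex F M : bsummable M -> (forall m, cmod (F m) <= M m) ->
  exists c, ctends \oo (fun N => boxsum N F) c.
Proof.
move=> Ms FM; have [tau [tau0 Mtau]] := bsummable_tail Ms.
have [U [UU ooU]] := ultraFilterLemma (@eventually_filter).
have [B MB] := Ms.2.
have [|c hc] := @ultra_ctends R nat U (fun N => boxsum N F) B UU.
  apply: nearW => N; apply: le_trans (MB N).
  by rewrite (le_trans (cmod_sum _ _ _)) // ler_sum.
exists c; apply: (ctends_squeeze _ tau0); apply: nearW => n.
rewrite -cmodN opprB.
apply: (@ctends_le _ _ U _ (fun N => boxsum N F - boxsum n F)).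
  by apply: ooU; exists n => // N /= nN; exact: (boxsum_tail FM).
by apply: ctendsD => //; exact: ctends_cst.
Qed.

Lemma boxsumZ N (a : R[i]) F : boxsum N (fun m => a * F m) = a * boxsum N F.
Proof. by rewrite !boxsumE mulr_sumr. Qed.

Lemma bsum_single F x : (forall m, m != x -> F m = 0) ->
  ctends \oo (fun N => boxsum N F) (F x).
Proof.
move=> F0; have [r xr] := boxseq_ex x.
apply: (@ctends_near _ _ \oo _ (fun=> F x)); last exact: ctends_cst.
exists r => // N /= rN; rewrite boxsumE (bigD1_seq x) ?boxseq_uniq //=.
  by rewrite big1 ?addr0.
exact: (boxseq_sub rN).
Qed.

(** The partial sums over [x], seen as functions of [y], are dominated by [SA * B y]. Dominated
    convergence in the size of the [x]-box then exchanges the two limits. *)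
Lemma bsum_fubini (f : Zg g -> Zg g -> R[i]) (A B : Zg g -> R)
    (r s : Zg g -> R[i]) (c : R[i]) :
  bsummable A -> bsummable B ->
  (forall y x, cmod (f y x) <= A x * B y) ->
  (forall x, ctends \oo (fun N => boxsum N (f^~ x)) (r x)) ->
  (forall y, ctends \oo (fun N => boxsum N (f y)) (s y)) ->
  ctends \oo (fun N => boxsum N r) c -> ctends \oo (fun N => boxsum N s) c.
Proof.
move=> [A0 [SA hA]] [B0 [SB hB]] fAB fr fs rc.
have SA0 : 0 <= SA by apply: le_trans (hA 0%N); rewrite boxsumE sumr_ge0.
apply: (@dominated_ctends _ \oo _ (fun n y => boxsum n (f y)) s
  (fun y => SA * B y) (fun n => boxsum n r)) => //.
- split=> [m|]; first exact: mulr_ge0.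
  by exists (SA * SB) => N; rewrite boxsumE -mulr_sumr -boxsumE ler_wpM2l.
- apply: nearW => n y; rewrite (le_trans (cmod_sum _ _ _))//.
  apply: (@le_trans _ _ (boxsum n A * B y)); last by rewrite ler_wpM2r.
  by rewrite /boxsum mulr_suml ler_sum.
- apply: nearW => n.
  rewrite [X in ctends _ X _](_ : _ = fun N => \sum_(m <- boxseq n) boxsum N (f^~ m)).
    by rewrite boxsumE; apply: ctends_sum.
  by apply/funext => N; rewrite /boxsum exchange_big /= -[RHS]boxsumE.
Qed.

(** If the box of radius [r] contains [e], the translate by [e] of the box of radius [n + r]
    contains the box of radius [n] and lies in that of radius [n + r + r]; the two sums thus differ
    by at most [tau n]. *)
Lemma bsum_shift F M (e : Zg g) c : bsummable M -> (forall m, cmod (F m) <= M m) ->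
  ctends \oo (fun N => boxsum N F) c ->
  ctends \oo (fun N => boxsum N (fun m => F (m + e))) c.
Proof.
move=> Ms FM Fc; have [tau [tau0 Mtau]] := bsummable_tail Ms.
have [r er] := boxseq_ex e.
have {}er i : (`|e ord0 i|%N <= r)%N by move: er; rewrite mem_boxseq => /forallP.
suff H : ctends \oo (fun n => boxsum (n + r)%N (fun m => F (m + e))) c.
  by rewrite /ctends -(cvg_shiftn r); exact: H.
apply: (@ctends_squeeze _ _ \oo _ _ _ (fun n => tau n + cmod (boxsum n F - c))); last first.
  by rewrite -(addr0 0); apply: cvgD.
apply: nearW => n; rewrite -(subrK (boxsum n F) (boxsum (n + r) _)) -addrA.
rewrite (le_trans (cmodD _ _))// lerD2r.
apply: le_trans (Mtau n (n + r + r)%N).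
rewrite [X in cmod (X - _)](_ : _ = \sum_(m <- map (+%R^~ e) (boxseq (n + r))) F m).
  apply: sum_boxsum_dist => //.
  - by rewrite map_inj_uniq ?boxseq_uniq //; exact: addIr.
  - move=> m; rewrite mem_boxseq => /forallP H; apply/mapP.
    exists (m - e); last by rewrite subrK.
    rewrite mem_boxseq; apply/forallP => i; rewrite !mxE.
    have Hz (a b : int) : (`|a| <= n)%N -> (`|b| <= r)%N ->
      (absz (a - b)%R <= n + r)%N by lia.
    exact: Hz (H i) (er i).
  - move=> _ /mapP[m + ->]; rewrite !mem_boxseq => /forallP H.
    apply/forallP => i; rewrite !mxE.
    have Hz (a b : int) : (`|a| <= n + r)%N -> (`|b| <= r)%N ->
      (absz (a + b)%R <= n + r + r)%N by lia.
    exact: Hz (H i) (er i).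
by rewrite big_map boxsumE.
Qed.

End BoxSums.

(** * Exponential weights and uniform bounds for their lattice sums *)

Section ExponentialWeights.
Variable R : realType.

(* The sum telescopes: [G (t + 1) - G t = q ^+ `|t|] and [0 <= G <= 2 / (1 - q)]. *)
Lemma sum_expr_absz_le (q : R) (z : int) n : 0 <= q < 1 ->
  \sum_(k < n) q ^+ absz (k%:Z - z) <= 2 / (1 - q).
Proof.
move=> /andP[q0 q1]; have q'0 : 0 < 1 - q by rewrite subr_gt0.
pose G (t : int) : R := match t with
  | Posz k => (1 + q - q ^+ k) / (1 - q)
  | Negz k => q ^+ k.+2 / (1 - q)
  end.
have q'N0 : 1 - q != 0 by rewrite gt_eqF.
have G0 t : 0 <= G t.
  case: t => k; rewrite /G divr_ge0 ?exprn_ge0 ?(ltW q'0) //.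
  by rewrite addrAC addr_ge0 // subr_ge0 exprn_ile1 // ltW.
have G2 t : G t <= 2 / (1 - q).
  have qk k : 0 <= q ^+ k <= 1 by rewrite exprn_ge0 // exprn_ile1 // ltW.
  case: t => k; rewrite /G ler_pM2r ?invr_gt0 //.
    by have := qk k; lra.
  by have := qk k.+2; lra.
have GS t : G (t + 1) - G t = q ^+ absz t.
  case: t => [k|[|k]].
  - rewrite -PoszD addn1 /G /= exprS; field; exact: q'N0.
  - by rewrite /G /= expr1 expr0 expr2; field; exact: q'N0.
  - have -> : Negz k.+1 + 1 = Negz k by lia.
    by rewrite /G /= !exprS; field; exact: q'N0.
have -> : \sum_(k < n) q ^+ absz (k%:Z - z) = G (n%:Z - z) - G (- z).
  elim: n => [|n ih]; first by rewrite big_ord0 sub0r subrr.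
  rewrite big_ord_recr ih /= -GS.
  have -> : n.+1%:Z - z = n%:Z - z + 1 by lia.
  by ring.
by have := G0 (- z); have := G2 (n%:Z - z); lra.
Qed.

Variable g : nat.
Implicit Types (m x : Zg g) (a : R).

Definition expw a m : R := expR (- a * l1norm R m).

Lemma l1norm_ge0 m : 0 <= l1norm R m.
Proof. by apply: sumr_ge0 => i _; rewrite ler0z. Qed.

Lemma l1normN m : l1norm R (- m) = l1norm R m.
Proof. by apply: eq_bigr => i _; rewrite mxE normrN. Qed.

Lemma l1normD m x : l1norm R (m + x) <= l1norm R m + l1norm R x.
Proof.
by rewrite -big_split /=; apply: ler_sum => i _; rewrite mxE -rmorphD ler_int ler_normD.
Qed.

Lemma expw_ge0 a m : 0 <= expw a m.
Proof. exact: expR_ge0. Qed.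

Lemma expw_le1 a m : 0 <= a -> expw a m <= 1.
Proof.
by move=> a0; rewrite -expR0 ler_expR mulNr oppr_le0 mulr_ge0 // l1norm_ge0.
Qed.

Lemma expwN a m : expw a (- m) = expw a m.
Proof. by rewrite /expw l1normN. Qed.

Lemma expw_prod a m : expw a m = \prod_(i < g) expR (- a) ^+ absz (m ord0 i).
Proof.
rewrite /expw /l1norm mulr_sumr expR_sum; apply: eq_bigr => i _.
by rewrite -expRM_natr natr_absz.
Qed.

Definition wbound a : R := (2 / (1 - expR (- a))) ^+ g.

Lemma wbound_ge0 a : 0 < a -> 0 <= wbound a.
Proof.
by move=> a0; rewrite exprn_ge0 // divr_ge0 // subr_ge0 -expR0 ler_expR oppr_le0 ltW.
Qed.

(** The weight is a product over coordinates, so distributivity turns the box sum into a product of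
    [g] one-dimensional sums, each at most [2 / (1 - expR (- a))]. *)
Lemma boxsum_expw_le a x N : 0 < a -> boxsum N (fun m => expw a (m - x)) <= wbound a.
Proof.
move=> a0; rewrite /boxsum.
under eq_bigr do rewrite expw_prod.
pose E (i : 'I_g) (j : 'I_(2 * N + 1)) : R :=
  expR (- a) ^+ absz ((j : nat)%:Z - (N%:Z + x ord0 i))%R.
rewrite (eq_bigr (fun k : {ffun 'I_g -> 'I_(2 * N + 1)} => \prod_i E i (k i))); last first.
  by move=> k _; apply: eq_bigr => i _; rewrite !mxE /E opprD addrA.
rewrite -(bigA_distr_bigA E) /= /wbound.
rewrite -[X in _ ^+ X]card_ord -prodr_const; apply: ler_prod => i _.
rewrite sumr_ge0 => [|j _]; last by rewrite exprn_ge0 // expR_ge0.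
by rewrite sum_expr_absz_le // expR_ge0 -expR0 ltr_expR oppr_lt0.
Qed.

Lemma expw_summable a x (D : R) : 0 < a -> 0 <= D ->
  bsummable (fun m => D * expw a (m - x)).
Proof.
move=> a0 D0; split=> [m|]; first by rewrite mulr_ge0 // expw_ge0.
exists (D * wbound a) => N; rewrite boxsumE -mulr_sumr -boxsumE ler_wpM2l //.
exact: boxsum_expw_le.
Qed.

Lemma expw_summableN a x (D : R) : 0 < a -> 0 <= D ->
  bsummable (fun m => D * expw a (x - m)).
Proof.
move=> a0 D0; under eq_fun do rewrite -opprB expwN; exact: expw_summable.
Qed.

(* Triangle inequality on half of the exponents. *)
Lemma expw_mul_le a x y m : 0 <= a ->
  expw a (m - x) * expw a (y - x) <= expw (a / 2) (m - x) * expw (a / 2) (y - m).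
Proof.
move=> a0; rewrite /expw -!expRD ler_expR.
have := l1normD (y - x) (x - m); rewrite addrA subrK -(opprB m x) l1normN.
have := l1norm_ge0 (m - x); have := l1norm_ge0 (y - x).
move: (l1norm R (m - x)) (l1norm R (y - x)) (l1norm R (y - m)) => u v w u0 v0 h.
have : a * w <= a * (v + u) by rewrite ler_wpM2l.
have : 0 <= a * v by rewrite mulr_ge0.
have : 0 <= a * u by rewrite mulr_ge0.
by lra.
Qed.

End ExponentialWeights.

(** * Bessel's inequality and the number of eigenfunctions per localization center *)

Section Counting.
Variables (R : realType) (g : nat).

(** Bessel's inequality for the point mass at [m], whose projection onto the span of the family is
    the function [G] below. *)
Lemma bessel_seq (I : eqType) (phi : I -> Zg g -> R[i]) (s : seq I) m :
  (forall i, inner_is (phi i) (phi i) 1) ->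
  (forall i j, i <> j -> inner_is (phi i) (phi j) 0) ->
  uniq s -> \sum_(i <- s) cmod (phi i m) ^+ 2 <= 1.
Proof.
move=> phi1 phi0 us; set S := (X in X <= 1).
have S0 : 0 <= S by apply: sumr_ge0 => i _; rewrite sqr_ge0.
(* The norm squared of [G] and its value at [m] are both [S], whence [S ^ 2 <= S]. *)
pose G n := \sum_(i <- s) conjc (phi i m) * phi i n.
have GS : G m = S%:C%C.
  rewrite /G /S rmorph_sum; apply: eq_bigr => i _.
  by rewrite mulrC cmodJM.
have HG : ctends \oo (fun N => boxsum N (fun n => G n * conjc (G n))) S%:C%C.
  pose c (i j : I) : R[i] := (i == j)%:R.
  have phic i j : ctends \oo (fun N => boxsum N (fun n => phi i n * conjc (phi j n))) (c i j).
    rewrite /c; have [->|/eqP ij] := eqVneq i j; first exact: phi1.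
    exact: phi0.
  have -> : S%:C%C = \sum_(i <- s) \sum_(j <- s) (conjc (phi i m) * phi j m) * c i j.
    rewrite /S rmorph_sum; apply: eq_big_seq => i si.
    rewrite (bigD1_seq i) //= /c eqxx mulr1 mulrC big1 ?addr0; first by rewrite cmodJM.
    by move=> j ji; rewrite eq_sym (negbTE ji) mulr0.
  rewrite [X in ctends _ X _](_ : _ = fun N => \sum_(i <- s) \sum_(j <- s)
      (conjc (phi i m) * phi j m) * boxsum N (fun n => phi i n * conjc (phi j n))).
    apply: ctends_sum => i; apply: ctends_sum => j; apply: ctendsM; first exact: ctends_cst.
    exact: phic.
  apply/funext => N; under [RHS]eq_bigr do under eq_bigr do rewrite -boxsumZ boxsumE.
  rewrite boxsumE; under [RHS]eq_bigr do rewrite exchange_big /=.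
  rewrite exchange_big /=; apply: eq_bigr => n _.
  rewrite rmorph_sum mulr_suml; apply: eq_bigr => i _.
  rewrite mulr_sumr; apply: eq_bigr => j _.
  by rewrite rmorphM /= conjcK; ring.
have S2 : S ^+ 2 <= S.
  apply/ler_addgt0Pr => e e0.
  have [r mr] := boxseq_ex m.
  have H : \forall N \near \oo, (r <= N)%N by exists r.
  move/ctendsP : HG => /(_ _ e0) HG.
  have [N [+ rN]] := filter_ex (filterI HG H).
  have -> : boxsum N (fun n => G n * conjc (G n)) = (boxsum N (fun n => cmod (G n) ^+ 2))%:C%C.
    by rewrite /boxsum rmorph_sum; apply: eq_bigr => k _; rewrite cmodJM.
  rewrite -rmorphB cmod_real => /(le_lt_trans (ler_norm _)).
  rewrite ltrBlDl => /ltW; apply: le_trans.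
  rewrite boxsumE (bigD1_seq m) ?boxseq_uniq //=; last exact: (boxseq_sub rN).
  rewrite GS cmod_real ger0_norm // lerDl.
  by apply: sumr_ge0 => i _; rewrite sqr_ge0.
have [->//|S_neq0] := eqVneq S 0.
have S_gt0 : 0 < S by rewrite lt_def S_neq0.
by rewrite -(ler_pM2r S_gt0) mul1r -expr2.
Qed.

(** The density [S m] is at most [1] by Bessel and at most [k * (C * expw a (m - x)) ^+ 2] by decay,
    hence at most the geometric mean of the two. Its total mass is [k], so summing the mean gives
    [k <= Num.sqrt k * D]. The decay bound alone would leave a factor [k] on both sides. *)
Lemma card_fiber_le (I : eqType) (phi : I -> Zg g -> R[i]) (mpt : I -> Zg g)
    (a C : R) (x : Zg g) (s : seq I) :
  0 < a -> 0 < C ->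
  (forall i, inner_is (phi i) (phi i) 1) ->
  (forall i j, i <> j -> inner_is (phi i) (phi j) 0) ->
  (forall i m, cmod (phi i m) <= C * expw a (m - mpt i)) ->
  uniq s -> (forall i, i \in s -> mpt i = x) ->
  (size s)%:R <= (C * wbound g a) ^+ 2.
Proof.
move=> a0 C0 phi1 phi0 phiC us sx; set k : R := (size s)%:R; set D := C * _.
have k0 : 0 <= k by rewrite ler0n.
have D0 : 0 <= D by rewrite mulr_ge0 ?wbound_ge0 // ltW.
pose S m := \sum_(i <- s) cmod (phi i m) ^+ 2.
have SC m : S m <= Num.sqrt k * (C * expw a (m - x)).
  have S0 : 0 <= S m by apply: sumr_ge0 => i _; rewrite sqr_ge0.
  have wx0 := expw_ge0 a (m - x).
  rewrite -ler_sqr ?nnegrE //; last by rewrite !mulr_ge0 // ltW.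
  apply: (@le_trans _ _ (S m)).
    by rewrite expr2 ler_piMr // bessel_seq.
  rewrite exprMn sqr_sqrtr // /k -sum1_size natr_sum mulr_suml /S !big_seq.
  apply: ler_sum => i /sx <-; rewrite mul1r lerXn2r ?nnegrE //.
  - exact: cmod_ge0.
  - by rewrite mulr_ge0 ?expw_ge0 // ltW.
have kD : k <= Num.sqrt k * D.
  have := @ctends_le R nat \oo _
    (fun N => \sum_(i <- s) boxsum N (fun m => phi i m * conjc (phi i m))) k%:C%C
    (Num.sqrt k * D).
  rewrite cmod_real ger0_norm //; apply.
    apply: nearW => N.
    rewrite [X in cmod X](_ : _ = (boxsum N S)%:C%C); last first.
      rewrite /boxsum exchange_big rmorph_sum; apply: eq_bigr => l _ /=.
      by rewrite rmorph_sum; apply: eq_bigr => i _; rewrite cmodJM.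
    have S0 : 0 <= boxsum N S.
      by apply: sumr_ge0 => l _; apply: sumr_ge0 => i _; rewrite sqr_ge0.
    rewrite cmod_real ger0_norm // boxsumE.
    rewrite (le_trans (ler_sum _ (fun m _ => SC m))) // -!mulr_sumr.
    by rewrite ler_wpM2l // ler_wpM2l ?(ltW C0) // -boxsumE boxsum_expw_le.
  rewrite /k -sum1_size natr_sum rmorph_sum; apply: ctends_sum => i.
  by rewrite rmorph1; exact: phi1.
have [->|k_neq0] := eqVneq k 0; first by rewrite sqr_ge0.
have sk0 : 0 < Num.sqrt k by rewrite sqrtr_gt0 lt_def k_neq0.
rewrite -(sqr_sqrtr k0) lerXn2r ?nnegrE ?sqrtr_ge0 //.
by rewrite -(ler_pM2l sk0) -expr2 sqr_sqrtr.
Qed.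

(** A duplicate-free list of maximal length exhausts [P], since a missing element could be
    prepended. *)
Lemma bounded_enum (I : eqType) (P : I -> Prop) K :
  (forall s, uniq s -> (forall i, i \in s -> P i) -> (size s <= K)%N) ->
  exists s, [/\ uniq s, (size s <= K)%N & forall i, i \in s <-> P i].
Proof.
move=> H.
pose Q k := `[< exists s, [/\ uniq s, forall i, i \in s -> P i & size s = k] >].
have Q0 : exists k, Q k by exists 0%N; apply/asboolP; exists [::].
have QK k : Q k -> (k <= K)%N by move=> /asboolP[s [us sP <-]]; exact: H.
case: (ex_maxnP Q0 QK) => k /asboolP[s [us sP sk]] kmax.
exists s; split => // [|i]; first exact: H.
split=> [/sP//|Pi]; apply/negPn/negP => is_.
have /kmax : Q k.+1.
  apply/asboolP; exists (i :: s); split => /=; [|move=> j|].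
  - by rewrite is_ us.
  - by rewrite inE => /orP[/eqP ->//|/sP].
  - by rewrite sk.
by rewrite ltnn.
Qed.

End Counting.

(** * Eigenbases re-indexed by localization centers *)

Section Frames.
Variables (R : realType) (g : nat).
Implicit Types (V : Zg g -> R) (a C : R).

Definition ULE_const a C V :=
  exists (I : Type) (phi : I -> Zg g -> R[i]) (mpt : I -> Zg g),
    [/\ complete_orthonormal phi,
        forall n, eigenfunction (schrod V) (phi n) &
        forall n m, cmod (phi n m) <= C * expw a (m - mpt n)].

(* An orthonormal basis indexed by localization centers: center [x] carries [K]
   slots, unused ones being filled with the zero function.  The last clause is
   the resolution of the identity; the fourth one is the eigenvalue equation with
   the eigenvalue eliminated.  All clauses are closed under pointwise limits. *)
Definition frame K a C V (Phi : Zg g * 'I_K -> Zg g -> R[i]) :=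
  [/\ forall b m, cmod (Phi b m) <= C * expw a (m - b.1),
      forall b, Phi b = (fun=> 0) \/ inner_is (Phi b) (Phi b) 1,
      forall b c, b <> c -> inner_is (Phi b) (Phi c) 0,
      forall b n m, schrod V (Phi b) n * Phi b m = schrod V (Phi b) m * Phi b n &
      forall m n, ctends \oo (fun N => boxsum N
        (fun x => \sum_(j < K) Phi (x, j) m * conjc (Phi (x, j) n))) (m == n)%:R].

Lemma expw_l2 a C x (u : Zg g -> R[i]) : 0 < a -> 0 <= C ->
  (forall m, cmod (u m) <= C * expw a (m - x)) -> l2 u.
Proof.
move=> a0 C0 uC; exists (C ^+ 2 * wbound g a) => N.
apply: (@le_trans _ _ (boxsum N (fun m => C ^+ 2 * expw a (m - x)))); last first.
  by rewrite boxsumE -mulr_sumr -boxsumE ler_wpM2l ?sqr_ge0 // boxsum_expw_le.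
apply: ler_sum => k _; set m := (\row_i _).
apply: (@le_trans _ _ ((C * expw a (m - x)) ^+ 2)).
  by rewrite lerXn2r ?nnegrE ?cmod_ge0 // mulr_ge0 // expw_ge0.
rewrite exprMn ler_wpM2l ?sqr_ge0 // expr2 ler_piMl ?expw_ge0 //.
exact/expw_le1/ltW.
Qed.

Lemma l2_bounded (u : Zg g -> R[i]) : l2 u ->
  exists B, 0 <= B /\ forall m, cmod (u m) <= B.
Proof.
move=> [M uM]; have M0 : 0 <= M.
  by apply: le_trans (uM 0%N); apply: sumr_ge0 => k _; rewrite sqr_ge0.
exists (Num.sqrt M); split=> [|m]; first exact: sqrtr_ge0.
have [r mr] := boxseq_ex m.
rewrite -ler_sqr ?nnegrE ?cmod_ge0 ?sqrtr_ge0 // (sqr_sqrtr M0).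
apply: (le_trans _ (uM r)); rewrite boxsumE (bigD1_seq m) ?boxseq_uniq //= lerDl.
by apply: sumr_ge0 => i _; rewrite sqr_ge0.
Qed.

Lemma frame_sum_le K a C (Phi : Zg g * 'I_K -> Zg g -> R[i]) x m n :
  0 <= C -> (forall b m, cmod (Phi b m) <= C * expw a (m - b.1)) ->
  cmod (\sum_(j < K) Phi (x, j) m * conjc (Phi (x, j) n)) <=
    K%:R * C ^+ 2 * (expw a (m - x) * expw a (n - x)).
Proof.
move=> C0 PhiC; rewrite (le_trans (cmod_sum _ _ _)) //.
apply: (@le_trans _ _ (\sum_(j < K) C ^+ 2 * (expw a (m - x) * expw a (n - x)))).
  apply: ler_sum => j _; rewrite cmodM cmodJ.
  rewrite [leRHS](_ : _ = C * expw a (m - x) * (C * expw a (n - x))); last by ring.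
  by rewrite ler_pM ?cmod_ge0 // PhiC.
by rewrite sumr_const card_ord -[leLHS]mulr_natl -[leRHS]mulrA.
Qed.

(** The nonzero slots form the basis. For completeness, [psi n * k x n] is summed in both orders:
    over [n] first it vanishes by orthogonality, over [x] first it gives [psi m] by the resolution
    of the identity. *)
Lemma frame_ULE K a C V Phi : 0 < a -> 0 <= C ->
  @frame K a C V Phi -> ULE_const a C V.
Proof.
move=> a0 C0 [PhiC Phi1 Phi0 PhiE PhiI].
exists {b | Phi b <> (fun=> 0)}, (fun b => Phi (sval b)), (fun b => (sval b).1).
split=> [||b m]; last exact: PhiC.
- split.
  + by move=> b; apply: expw_l2 (PhiC _).
  + by move=> [b b0] /=; case: (Phi1 b).
  + move=> [b b0] [c c0] /= bc; apply: Phi0 => bc'; apply: bc.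
    by move: b0 c0; rewrite bc' => b0 c0; congr exist; exact: Prop_irrelevance.
  + move=> psi psi2 psiPhi; apply/funext => m.
    have psiPhi' b : ctends \oo (fun N => boxsum N (fun n => psi n * conjc (Phi b n))) 0.
      have [b0|b0] := pselect (Phi b = fun=> 0); last exact: (psiPhi (exist _ b b0)).
      rewrite b0 (_ : (fun N => _) = fun=> 0); first exact: ctends_cst.
      by apply/funext => N; rewrite boxsumE big1 // => n _; rewrite conjc0 mulr0.
    have [B [B0 psiB]] := l2_bounded psi2.
    pose k x n := \sum_(j < K) Phi (x, j) m * conjc (Phi (x, j) n).
    have key : ctends \oo (fun N => boxsum N (fun n => psi n * (m == n)%:R)) 0.
      have a20 : 0 < a / 2 by rewrite divr_gt0.
      have D0 : 0 <= B * (K%:R * C ^+ 2) by rewrite !mulr_ge0 ?sqr_ge0.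
      (* [expw_mul_le] spends half of the decay rate on [m - x] and half on [n - m], which makes the
         dominating function a product. *)
      apply: (@bsum_fubini _ R (fun n x => psi n * k x n)
        (fun x => B * (K%:R * C ^+ 2) * expw (a / 2) (m - x))
        (fun n => 1 * expw (a / 2) (n - m)) (fun=> 0)).
      * exact: expw_summableN.
      * exact: expw_summable.
      * move=> n x; rewrite cmodM.
        apply: (@le_trans _ _ (B * (K%:R * C ^+ 2 * (expw a (m - x) * expw a (n - x))))).
          by rewrite ler_pM ?cmod_ge0 // frame_sum_le.
        rewrite mul1r -!mulrA !ler_wpM2l ?sqr_ge0 //.
        by apply: expw_mul_le; exact: ltW.
      * move=> x; rewrite [X in ctends _ X _](_ : _ = fun N => \sum_(j < K)
          Phi (x, j) m * boxsum N (fun n => psi n * conjc (Phi (x, j) n))); last first.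
          apply/funext => N; under [RHS]eq_bigr do rewrite -boxsumZ boxsumE.
          rewrite exchange_big boxsumE; apply: eq_bigr => n _ /=.
          by rewrite mulr_sumr; apply: eq_bigr => j _; ring.
        rewrite [X in ctends _ _ X](_ : _ = \sum_(j < K) Phi (x, j) m * 0); last first.
          by rewrite big1 // => j _; rewrite mulr0.
        by apply: ctends_sum => j; apply: ctendsM => //; exact: ctends_cst.
      * move=> n; under eq_fun do rewrite boxsumZ.
        by apply: ctendsM; [exact: ctends_cst | exact: PhiI].
      * rewrite (_ : (fun N => _) = fun=> 0); first exact: ctends_cst.
        by apply/funext => N; rewrite boxsumE big1.
    have := @bsum_single _ R (fun n => psi n * (m == n)%:R) m.
    rewrite eqxx mulr1 => H; apply: (ctends_unique (H _) key) => n nm.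
    by rewrite eq_sym (negbTE nm) mulr0.
- move=> [b b0] /=; split => //; first exact: expw_l2 (PhiC _).
  (* The eigenvalue is read off at a point where the eigenfunction does not vanish. *)
  have [m bm] : exists m, Phi b m <> 0.
    apply/existsNP => H; apply: b0; exact/funext.
  exists (schrod V (Phi b) m / Phi b m) => n.
  by rewrite mulrAC -PhiE mulfK //; exact/eqP.
Qed.

(** The bound of [card_fiber_le], rounded down; it is the same for all potentials. *)
Definition slots a C : nat := Num.truncn ((C * wbound g a) ^+ 2).

(** The eigenfunctions centered at [x] are at most [slots a C] in number and fill the slots of [x]
    in the order of the list [sq x]. The resolution of the identity is the expansion of point
    masses, which follows from completeness. *)
Lemma ULE_frame a C V : 0 < a -> 0 < C -> ULE_const a C V ->
  exists Phi, @frame (slots a C) a C V Phi.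
Proof.
move=> a0 C0 [I0 [phi [mpt [[phi2 phi1 phi0 phic] phiE phiC]]]].
(* [{classic I0}] gives the index type the decidable equality that duplicate-free lists require. *)
pose I := {classic I0}; set K := slots a C.
have fib x : exists s : seq I,
    [/\ uniq s, (size s <= K)%N & forall i, i \in s <-> mpt i = x].
  apply: bounded_enum => s us sx; rewrite -(ler_nat R).
  have H := @card_fiber_le R g I phi mpt a C x s a0 C0 phi1 phi0 phiC us sx.
  have D2 : 0 <= (C * wbound g a) ^+ 2 by rewrite sqr_ge0.
  by rewrite ler_nat truncn_ge_nat.
have [sq /all_and3[squ sqK sqP]] := choice fib.
(* The default value [None] marks an empty slot. *)
pose slot (b : Zg g * 'I_K) : option I := nth None (map Some (sq b.1)) b.2.
pose Phi b : Zg g -> R[i] := if slot b is Some i then phi i else fun=> 0.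
have slotP b i : slot b = Some i ->
    [/\ (b.2 < size (sq b.1))%N, mpt i = b.1 & b.2 = index i (sq b.1) :> nat].
  rewrite /slot; have [lt|ge] := ltnP b.2 (size (sq b.1)); last first.
    by rewrite nth_default ?size_map.
  rewrite (nth_map i) // => -[<-]; rewrite index_uniq //; split => //.
  by apply/sqP; rewrite mem_nth.
have slot_inj b c i : slot b = Some i -> slot c = Some i -> b = c.
  move=> /slotP[_ b1 b2] /slotP[_ c1 c2].
  case: b c b1 b2 c1 c2 => [x j] [y k] /= <- b2 <- c2; congr pair.
  by apply: val_inj; rewrite /= b2 c2.
have slot_ex (i : I) : exists j, slot (mpt i, j) = Some i.
  have isq : i \in sq (mpt i) by apply/sqP.
  have lt : (index i (sq (mpt i)) < size (sq (mpt i)))%N by rewrite index_mem.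
  exists (Ordinal (leq_trans lt (sqK _))).
  by rewrite /slot /= (nth_map i) // nth_index.
have PhiC b m : cmod (Phi b m) <= C * expw a (m - b.1).
  rewrite /Phi; case: (slot b) (slotP b) => [i /(_ _ erefl)[_ <- _]|_]; first exact: phiC.
  by rewrite cmod0 mulr_ge0 ?expw_ge0 // ltW.
have inner0 (u : Zg g -> R[i]) : inner_is u (fun=> 0) 0 /\ inner_is (fun=> 0) u 0.
  by split; rewrite /inner_is (_ : (fun N => _) = fun=> 0); (try exact: ctends_cst);
    apply/funext => N; rewrite boxsumE big1 // => m _; rewrite ?conjc0 ?mulr0 ?mul0r.
have Phi0 b c : b <> c -> inner_is (Phi b) (Phi c) 0.
  move=> bc; rewrite /Phi; case bi: (slot b) => [i|]; last exact: (inner0 _).2.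
  case cj: (slot c) => [j|]; last exact: (inner0 _).1.
  by apply: phi0 => ij; apply: bc; apply: slot_inj bi _; rewrite ij.
exists Phi; split => //.
- by move=> b; rewrite /Phi; case: (slot b) => [i|]; [right; exact: phi1 | left].
- move=> b n m; rewrite /Phi; case: (slot b) => [i|]; last by rewrite !mulr0.
  by have [_ _ [E HE]] := phiE i; rewrite !HE; ring.
move=> m n.
have a20 : 0 < a / 2 by rewrite divr_gt0.
have D0 : 0 <= K%:R * C ^+ 2 by rewrite mulr_ge0 ?ler0n ?sqr_ge0.
have half_le x y : expw a (m - x) * expw a (y - x) <=
    expw (a / 2) (m - x) * expw (a / 2) (y - m).
  by apply: expw_mul_le; exact: ltW.
pose k x y := \sum_(j < K) Phi (x, j) m * conjc (Phi (x, j) y).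
have kle x y : cmod (k x y) <= K%:R * C ^+ 2 * expw (a / 2) (m - x) * expw (a / 2) (y - m).
  by rewrite (le_trans (frame_sum_le _ _ _ (ltW C0) PhiC)) // -[leRHS]mulrA ler_wpM2l // half_le.
have w1 x : expw (a / 2) x <= 1 by apply: expw_le1; exact: ltW.
(* [conjc (S y)] is the value at [y] of the expansion of the point mass at [m]. *)
have /choice[S HS] : forall y, exists c, ctends \oo (fun N => boxsum N (k^~ y)) c.
  move=> y; apply: (@bsum_ex _ _ _ (fun x => K%:R * C ^+ 2 * expw (a / 2) (m - x))).
    exact: expw_summableN.
  by move=> x; rewrite (le_trans (kle x y)) // ler_piMr // mulr_ge0 // expw_ge0.
suff -> : (m == n)%:R = S n by exact: HS.
(* [psi] is [delta_m] minus its expansion in the basis; it is orthogonal to it. *)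
pose psi y : R[i] := (m == y)%:R - conjc (S y).
suff : psi = fun=> 0.
  move/(congr1 (fun u => conjc (u n))); rewrite /psi conjc0 rmorphB /= conjcK conjc_nat.
  by move/subr0_eq.
(* This decay puts [psi] in [l2], as completeness requires. *)
have SB y : cmod (S y) <= K%:R * C ^+ 2 * wbound g (a / 2) * expw (a / 2) (y - m).
  apply: (ctends_le _ (HS y)); apply: nearW => N.
  rewrite (le_trans (cmod_sum _ _ _)) //.
  apply: (@le_trans _ _ (boxsum N (fun x =>
      K%:R * C ^+ 2 * expw (a / 2) (m - x) * expw (a / 2) (y - m)))).
    by apply: ler_sum => l _; exact: kle.
  rewrite boxsumE -mulr_suml -mulr_sumr ler_wpM2r ?expw_ge0 // ler_wpM2l //.
  rewrite (eq_bigr (fun x => expw (a / 2) (x - m))); last by move=> x _; rewrite -expwN opprB.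
  by rewrite -boxsumE boxsum_expw_le.
apply: phic.
- apply: (@expw_l2 (a / 2) (1 + K%:R * C ^+ 2 * wbound g (a / 2)) m) => //.
    by rewrite addr_ge0 // mulr_ge0 // wbound_ge0.
  move=> y; rewrite (le_trans (cmodD _ _)) // cmodN cmodJ mulrDl lerD //.
  have [<-|_] := eqVneq m y; last by rewrite cmod0 mul1r expw_ge0.
  by rewrite subrr cmod1 mul1r /expw /l1norm big1 ?mulr0 ?expR0 // => i _; rewrite mxE normr0.
- move=> i; have [j0 ij0] := slot_ex i; set b := (mpt i, j0).
  have Phib : Phi b = phi i by rewrite /Phi ij0.
  have H1 : ctends \oo (fun N => boxsum N (fun y => (m == y)%:R * conjc (phi i y)))
      (conjc (phi i m)).
    have := @bsum_single _ R (fun y => (m == y)%:R * conjc (phi i y)) m.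
    rewrite eqxx mul1r; apply => y ym.
    by rewrite eq_sym (negbTE ym) mul0r.
  have H2 : ctends \oo (fun N => boxsum N (fun y => - conjc (S y) * conjc (phi i y)))
      (- conjc (phi i m)).
    (* Summed over [y] first, orthonormality kills every slot except [b], the one holding [phi i];
       [r x] is the remaining contribution of center [x]. *)
    pose r x : R[i] := if x == mpt i then - conjc (phi i m) else 0.
    apply: (@bsum_fubini _ R (fun y x => - conjc (k x y) * conjc (phi i y))
        (fun x => K%:R * C ^+ 2 * C * expw (a / 2) (m - x))
        (fun y => 1 * expw (a / 2) (y - m)) r).
    + by apply: expw_summableN; rewrite // mulr_ge0 // ltW.
    + exact: expw_summable.
    + move=> y x; rewrite cmodM cmodN !cmodJ mul1r.
      apply: (@le_trans _ _
        (K%:R * C ^+ 2 * expw (a / 2) (m - x) * expw (a / 2) (y - m) * C)); last first.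
        by rewrite le_eqVlt; apply/orP; left; apply/eqP; ring.
      rewrite ler_pM ?cmod_ge0 // (le_trans (phiC i y)) // ler_piMr ?(ltW C0) //.
      exact/expw_le1/ltW.
    + move=> x.
      have HK : ctends \oo (fun N => \sum_(j < K) - conjc (Phi (x, j) m) *
            boxsum N (fun y => Phi (x, j) y * conjc (Phi b y)))
          (\sum_(j < K) - conjc (Phi (x, j) m) * ((x, j) == b)%:R).
        apply: ctends_sum => j; apply: ctendsM; first exact: ctends_cst.
        have [->|/eqP /Phi0//] := eqVneq (x, j) b.
        by rewrite Phib; exact: phi1.
      rewrite [r x](_ : _ = \sum_(j < K) - conjc (Phi (x, j) m) * ((x, j) == b)%:R); last first.
        rewrite /r /b; have [->|xi] := eqVneq x (mpt i); last first.
          by rewrite big1 // => j _; rewrite xpair_eqE (negbTE xi) mulr0.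
        rewrite (bigD1 j0) //= eqxx mulr1 big1 ?addr0 ?Phib // => j jj0.
        by rewrite xpair_eqE (negbTE jj0) andbF mulr0.
      apply: (@ctends_near _ _ \oo _ _ _ _ _ HK); apply: nearW => N.
      under eq_bigr do rewrite -boxsumZ boxsumE.
      rewrite exchange_big boxsumE; apply: eq_bigr => y _ /=.
      rewrite Phib /k rmorph_sum -sumrN mulr_suml; apply: eq_bigr => j _.
      by rewrite rmorphM /= conjcK; ring.
    + move=> y; rewrite [X in ctends _ X _](_ : _ =
          fun N => - conjc (phi i y) * conjc (boxsum N (k^~ y))).
        by rewrite mulNr -mulrN mulrC; apply: ctendsM; [exact: ctends_cst | exact: ctendsJ].
      apply/funext => N; rewrite !boxsumE rmorph_sum mulr_sumr.
      by apply: eq_bigr => x _; ring.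
    + have ri : r (mpt i) = - conjc (phi i m) by rewrite /r eqxx.
      by rewrite -ri; apply: bsum_single => x /negbTE; rewrite /r => ->.
  have H3 := ctendsD H1 H2; rewrite subrr in H3.
  apply: (@ctends_near _ _ \oo _ _ _ _ _ (H3 _)); apply: nearW => N.
  by rewrite !boxsumE -big_split; apply: eq_bigr => y _ /=; rewrite /psi mulrDl.
Qed.

End Frames.

(** * Closedness of uniform localization under limits of potentials *)

Section LimitsOfULE.
Variables (R : realType) (g : nat).
Implicit Types (V : Zg g -> R) (a C : R).

Lemma ctends_schrod (T : Type) (F : set_system T) (FF : ProperFilter F)
    (Vt : T -> Zg g -> R) V (h : T -> Zg g -> R[i]) (u : Zg g -> R[i]) n :
  (forall m, (fun t => Vt t m) @ F --> V m) ->
  (forall m, ctends F (fun t => h t m) (u m)) ->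
  ctends F (fun t => schrod (Vt t) (h t) n) (schrod V u n).
Proof.
move=> VtV hu; apply: ctendsD.
  by apply: ctends_sum => i; apply: ctendsD; exact: hu.
apply: ctendsM; last exact: hu.
by apply/ctends_ReIm; split; [exact: VtV | exact: cvg_cst].
Qed.

(** All frames share the index set [Zg g * 'I_K], and their bounded values converge simultaneously
    along an ultrafilter. The limit [Psi] is again a frame, the infinite sums being handled by
    dominated convergence. *)
Lemma ULE_const_ultra_lim (T : Type) (F : set_system T) (UF : UltraFilter F)
    a C (Vt : T -> Zg g -> R) V :
  0 < a -> 0 < C ->
  (forall m, (fun t => Vt t m) @ F --> V m) ->
  (\forall t \near F, ULE_const a C (Vt t)) -> ULE_const a C V.
Proof.
move=> a0 C0 VtV hF; set K := slots g a C.
have /choice[Phi PhiP] : forall t, exists Phi, ULE_const a C (Vt t) ->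
    @frame R g K a C (Vt t) Phi.
  move=> t; have [/(ULE_frame a0 C0)[Phi PhiF]|H] := pselect (ULE_const a C (Vt t)).
    by exists Phi.
  (* A placeholder at those [t] where localization fails; [F] contains the set of the others. *)
  by exists (fun _ _ => 0) => /H.
have {PhiP}PhiF : \forall t \near F, frame a C (Vt t) (Phi t).
  by apply: filterS hF => t; exact: PhiP.
have PhiC b m : \forall t \near F, cmod (Phi t b m) <= C * expw a (m - b.1).
  by apply: filterS PhiF => t [].
have /choice[Psi0 Psi0P] : forall bm : (Zg g * 'I_K) * Zg g,
    exists c, ctends F (fun t => Phi t bm.1 bm.2) c.
  by move=> [b m]; apply: ultra_ctends (PhiC b m).
pose Psi b m := Psi0 (b, m).
have PsiP b m : ctends F (fun t => Phi t b m) (Psi b m) := Psi0P (b, m).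
have w1 m : expw a m <= 1 by apply: expw_le1; exact: ltW.
have dom b c : \forall t \near F, forall m,
    cmod (Phi t b m * conjc (Phi t c m)) <= C ^+ 2 * expw a (m - b.1).
  apply: filterS PhiF => t [H _ _ _ _] m; rewrite cmodM cmodJ.
  apply: (@le_trans _ _ (C * expw a (m - b.1) * C)).
    rewrite ler_pM ?cmod_ge0 // (le_trans (H _ _)) // ler_piMr //.
    exact: ltW.
  by rewrite mulrAC -expr2.
have inner_lim b c (d : R[i]) : (\forall t \near F, inner_is (Phi t b) (Phi t c) d) ->
    inner_is (Psi b) (Psi c) d.
  move=> H; apply: (@dominated_ctends g R T F _ _ _ _ (fun=> d) d _ (dom b c)) => //.
  - by apply: expw_summable; rewrite ?sqr_ge0.
  - by move=> m; apply: ctendsM => //; exact: ctendsJ.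
  - exact: ctends_cst.
apply: (@frame_ULE _ _ K a C V Psi a0 (ltW C0)); split.
- by move=> b m; apply: ctends_le (PhiC b m) (PsiP b m).
(* The ultrafilter decides whether slot [b] is empty in the limit, so a normalized slot cannot
   degenerate. *)
- move=> b; have [Z|NZ] := in_ultra_setVsetC [set t | Phi t b = fun=> 0] UF.
    left; apply/funext => m; apply: (ctends_unique (PsiP b m)).
    apply: (@ctends_near _ _ F _ (fun=> 0)); last exact: ctends_cst.
    by apply: filterS Z => t /= ->.
  right; apply: inner_lim; apply: filterS2 NZ PhiF => t /= tZ [_ H _ _ _].
  by case: (H b).
- by move=> b c bc; apply: inner_lim; apply: filterS PhiF => t [_ _ H _ _]; exact: H.
- move=> b n m.
  have L i j : ctends F (fun t => schrod (Vt t) (Phi t b) i * Phi t b j)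
      (schrod V (Psi b) i * Psi b j).
    by apply: ctendsM; [exact: ctends_schrod | exact: PsiP].
  apply: (ctends_unique (L n m)); apply: (ctends_near _ (L m n)).
  by apply: filterS PhiF => t [_ _ _ H _]; exact: H.
- move=> m n.
  apply: (@dominated_ctends g R T F _
    (fun t x => \sum_(j < K) Phi t (x, j) m * conjc (Phi t (x, j) n)) _
    (fun x => K%:R * C ^+ 2 * expw a (m - x)) (fun=> (m == n)%:R)).
  + by apply: expw_summableN => //; rewrite mulr_ge0 ?ler0n ?sqr_ge0.
  + apply: filterS PhiF => t [H _ _ _ _] x.
    rewrite (le_trans (frame_sum_le _ _ _ (ltW C0) H)) // ler_wpM2l //.
      by rewrite mulr_ge0 ?ler0n ?sqr_ge0.
    by rewrite ler_piMr ?expw_ge0.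
  + by move=> x; apply: ctends_sum => j; apply: ctendsM; [|apply: ctendsJ]; exact: PsiP.
  + by apply: filterS PhiF => t [_ _ _ _ H]; exact: H.
  + exact: ctends_cst.
Qed.

(** In a general topological space a closure point is approached along an ultrafilter: one refining
    the trace on [S] of its neighbourhood filter. *)
Lemma closed_ULE_const (X : topologicalType) a C (Vt : X -> Zg g -> R) :
  0 < a -> 0 < C -> (forall m, continuous (fun w => Vt w m)) ->
  closed [set w | ULE_const a C (Vt w)].
Proof.
move=> a0 C0 Vc w Sw; set S := [set w | _] in Sw *.
have PF : ProperFilter (within S (nbhs w)).
  by apply/within_nbhs_proper.
have [G [UG sG]] := ultraFilterLemma PF.
have GS : G S by apply: sG; rewrite /within /=; apply: nearW.
apply: (@ULE_const_ultra_lim X G UG a C Vt (Vt w)) => // m A hA.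
apply: sG; move: (Vc m w A hA).
by apply: (@filterS _ (nbhs w) _) => t At _; exact: At.
Qed.

End LimitsOfULE.

(** * Invariance of uniform localization under lattice translations *)

Section Translation.
Variables (R : realType) (g : nat).
Implicit Types (V : Zg g -> R) (a C : R) (e : Zg g).

Lemma l2_shift (u : Zg g -> R[i]) e : l2 u -> l2 (fun m => u (m + e)).
Proof.
move=> [M uM]; exists M => N; have [r er] := boxseq_ex e.
apply: le_trans (uM (N + r)%N); rewrite !boxsumE.
rewrite -(big_map (+%R^~ e) xpredT (fun m => cmod (u m) ^+ 2)).
rewrite (@sum_subset _ _ (map (+%R^~ e) (boxseq g N)) (boxseq g (N + r))) ?boxseq_uniq //.
- by rewrite lerDl sumr_ge0 // => m _; rewrite sqr_ge0.
- by rewrite map_inj_uniq ?boxseq_uniq //; exact: addIr.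
- move=> _ /mapP[m + ->]; move: er; rewrite !mem_boxseq => /forallP er /forallP H.
  apply/forallP => i; rewrite !mxE.
  have Hz (x y : int) : (`|x| <= N)%N -> (`|y| <= r)%N ->
    (absz (x + y)%R <= N + r)%N by lia.
  exact: Hz (H i) (er i).
Qed.

(** Translating the eigenfunctions and their centers together preserves both constants. *)
Lemma ULE_const_shift a C V e : 0 < a -> 0 < C -> ULE_const a C V ->
  ULE_const a C (fun n => V (n + e)).
Proof.
move=> a0 C0 [I [phi [mpt [[phi2 phi1 phi0 phic] phiE phiC]]]].
have w1 m : expw a m <= 1 by apply: expw_le1; exact: ltW.
exists I, (fun i m => phi i (m + e)), (fun i => mpt i - e).
have phiC' i m : cmod (phi i (m + e)) <= C * expw a (m - (mpt i - e)).
  by rewrite opprB addrCA addrA (addrC e); exact: phiC.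
have inner_shift i j d : inner_is (phi i) (phi j) d ->
    inner_is (fun m => phi i (m + e)) (fun m => phi j (m + e)) d.
  move=> H; apply: (@bsum_shift g R (fun m => phi i m * conjc (phi j m))
      (fun m => C ^+ 2 * expw a (m - mpt i))) => //.
    by apply: expw_summable; rewrite ?sqr_ge0.
  move=> m; rewrite cmodM cmodJ.
  apply: (@le_trans _ _ (C * expw a (m - mpt i) * C)).
    by rewrite ler_pM ?cmod_ge0 // (le_trans (phiC _ _)) // ler_piMr // ltW.
  by rewrite mulrAC -expr2.
split=> //.
- split.
  + by move=> i; exact: l2_shift.
  + by move=> i; exact: inner_shift.
  + by move=> i j ij; apply: inner_shift; exact: phi0.
  + move=> psi psi2 psiphi; have [B [B0 psiB]] := l2_bounded psi2.
    (* Completeness is transported by translating [psi] back, which makes it orthogonal to the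
       original basis. *)
    have H : (fun m => psi (m - e)) = fun=> 0.
      apply: phic => [|i]; first exact: l2_shift.
      rewrite /inner_is (_ : (fun N => _) = fun N =>
          boxsum N (fun m => psi (m - e) * conjc (phi i (m - e + e)))); last first.
        by apply/funext => N; rewrite !boxsumE; apply: eq_bigr => m _; rewrite subrK.
      apply: (@bsum_shift g R (fun m => psi m * conjc (phi i (m + e)))
        (fun m => B * C * expw a (m - (mpt i - e))) (- e) 0 _ _ (psiphi i)).
        by apply: expw_summable => //; rewrite mulr_ge0 // ltW.
      by move=> m; rewrite cmodM cmodJ -mulrA ler_pM ?cmod_ge0.
    apply/funext => m; have := congr1 (fun u => u (m + e)) H.
    by rewrite addrK.
- move=> i; have [h1 h2 [E HE]] := phiE i; split; first exact: l2_shift.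
    move=> z; apply: h2; apply/funext => m; have := congr1 (fun u => u (m - e)) z.
    by rewrite subrK.
  exists E => n; rewrite -HE /schrod; congr (_ + _).
  by apply: eq_bigr => j _; rewrite !(addrAC _ _ e).
Qed.

End Translation.

(** * The lattice action generated by commuting homeomorphisms *)

Section Powers.
Variables (X : Type) (g : nat) (T Tinv : 'I_g -> X -> X).
Hypotheses (hTK : forall i, cancel (T i) (Tinv i))
  (hTinvK : forall i, cancel (Tinv i) (T i))
  (hcomm : forall i j, T i \o T j = T j \o T i).

Lemma titer_comm i j z w : titer (T i) (Tinv i) z (T j w) = T j (titer (T i) (Tinv i) z w).
Proof.
have Tij u : T i (T j u) = T j (T i u) by have := congr1 (fun f => f u) (hcomm i j).
have Tinvij u : Tinv i (T j u) = T j (Tinv i u).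
  by apply: (can_inj (hTK i)); rewrite Tij !hTinvK.
have iter_comm f n u : (forall v, f (T j v) = T j (f v)) ->
    iter n f (T j u) = T j (iter n f u).
  by move=> fT; elim: n => //= n ->.
by case: z => k; exact: iter_comm.
Qed.

Lemma titer_add1 i z w : titer (T i) (Tinv i) (z + 1) w = T i (titer (T i) (Tinv i) z w).
Proof.
case: z => [k|[|k]]; first by rewrite -PoszD addn1.
  by rewrite /= hTinvK.
have -> : Negz k.+1 + 1 = Negz k by lia.
by rewrite /= hTinvK.
Qed.

(** This turns the action on the space into translation of the potential. The extra [T i] commutes
    past the other factors to the one of index [i]. *)
Lemma Tpow_step i n w : Tpow T Tinv n (T i w) = Tpow T Tinv (n + unitv i) w.
Proof.
rewrite /Tpow; set fold := fun (m : Zg g) (s : seq 'I_g) =>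
  foldr (fun i h => titer (T i) (Tinv i) (m ord0 i) \o h) id s.
rewrite -/(fold n (enum 'I_g)) -/(fold (n + unitv i) (enum 'I_g)).
have comm s : fold n s (T i w) = T i (fold n s w).
  by elim: s => //= j s ->; rewrite titer_comm.
have : uniq (enum 'I_g) by exact: enum_uniq.
(* The induction runs over duplicate-free lists, in which [i] contributes its extra factor at most
   once. *)
suff H s : uniq s -> fold (n + unitv i) s w =
    if i \in s then T i (fold n s w) else fold n s w.
  by move=> /H ->; rewrite mem_enum comm.
elim: s => //= j s ih /andP[js us]; rewrite ih // inE.
have -> : (n + unitv i) ord0 j = n ord0 j + (j == i)%:R by rewrite !mxE eqxx.
have [ij|ij] := eqVneq i j.
  by rewrite -{}ij in js *; rewrite (negbTE js) titer_add1.
rewrite addr0 /=.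
by case: (i \in s) => //; rewrite titer_comm.
Qed.

End Powers.

Lemma Tpow_continuous (X : topologicalType) (g : nat) (T Tinv : 'I_g -> X -> X)
    (n : Zg g) :
  (forall i, continuous (T i)) -> (forall i, continuous (Tinv i)) ->
  continuous (Tpow T Tinv n).
Proof.
move=> Tc Tinvc.
have iter_cont (h : X -> X) k : continuous h -> continuous (iter k h).
  move=> hc; elim: k => [|k ih] w; first exact: cvg_id.
  exact: (@continuous_comp _ _ _ (iter k h) h w (ih w) (hc _)).
have titer_cont i z : continuous (titer (T i) (Tinv i) z).
  by case: z => k; exact: iter_cont.
rewrite /Tpow; elim: (enum 'I_g) => [|i s ih] w /=; first exact: cvg_id.
by apply: continuous_comp; [exact: ih | exact: titer_cont].
Qed.

(** * Measurability, ergodicity and the uniform decay rate *)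

Lemma closed_measurable (X : ptopologicalType) (A : set X) :
  closed A -> measurable (A : set (g_sigma_algebraType (@open X))).
Proof.
move=> cA; rewrite -(setCK A); apply: measurableC.
by apply: sub_sigma_algebra; exact: closed_openC.
Qed.

(** Monotonicity in both constants allows countably many pairs to replace all real ones. *)
Lemma ULE_const_le (R : realType) g (a b C D : R) (V : Zg g -> R) :
  b <= a -> 0 <= C -> C <= D -> ULE_const a C V -> ULE_const b D V.
Proof.
move=> ba C0 CD [I [phi [mpt [H1 H2 H3]]]]; exists I, phi, mpt; split=> // i m.
apply: le_trans (H3 i m) _; rewrite ler_pM ?expw_ge0 // ler_expR.
by rewrite ler_wpM2r ?l1norm_ge0 // lerN2.
Qed.

(** If no [A k] has a null complement, ergodicity makes every [A k] null, hence also their union. *)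
Lemma ae_bigcup_invariant (d : measure_display) (R : realType) (X : measurableType d)
    (g : nat) (mu : {measure set X -> \bar R}) (T : 'I_g -> X -> X)
    (A : nat -> set X) :
  ergodic mu T -> (forall k, measurable (A k)) ->
  (forall k i, T i @^-1` A k = A k) ->
  {ae mu, forall w, (\bigcup_k A k) w} ->
  exists k, {ae mu, forall w, A k w}.
Proof.
move=> [_ erg] mA TA aeA.
have [[k Ak]|H] := pselect (exists k, mu (~` A k) = 0%E).
  by exists k; exists (~` A k); split => //; exact: measurableC.
have A0 k : mu.-negligible (A k).
  have [Ak|Ak] := erg _ (mA k) (TA k); first by exists (A k); split.
  by case: H; exists k.
have UA : mu.-negligible (\bigcup_k A k) by exact: negligible_bigcup.
(* Here the union and its complement are both negligible, so the measure is zero and any index will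
   do. *)
exists 0%N; rewrite /almost_everywhere.
apply: (negligibleS _ (negligibleU aeA UA)) => w _.
by have [|] := pselect ((\bigcup_k A k) w); [right|left].
Qed.

Theorem theorem2p2 (R : realType) (g : nat) (Omega : ptopologicalType)
  (T Tinv : 'I_g -> Omega -> Omega)
  (hTK : forall i, cancel (T i) (Tinv i))
  (hTinvK : forall i, cancel (Tinv i) (T i))
  (hTc : forall i, continuous (T i))
  (hTinvc : forall i, continuous (Tinv i))
  (hcomm : forall i j, T i \o T j = T j \o T i)
  (mu : {measure set (g_sigma_algebraType (@open Omega)) -> \bar R})
  (herg : ergodic mu T)
  (f : Omega -> R) (hf : continuous f)
  (hULE : {ae mu, forall w,
             ULE (schrod (fun n => f (Tpow T Tinv n w)))}) :
  exists alpha : R, 0 < alpha /\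
    {ae mu, forall w,
       ULE_with alpha (schrod (fun n => f (Tpow T Tinv n w)))}.
Proof.
pose V (w : Omega) (n : Zg g) := f (Tpow T Tinv n w).
have Vc n : continuous (fun w => V w n).
  move=> w; apply: (@continuous_comp _ _ _ (Tpow T Tinv n) f w); last exact: hf.
  exact: Tpow_continuous.
have VT i w n : V (T i w) n = V w (n + unitv i) by rewrite /V Tpow_step.
pose a k : R := k.+1%:R^-1.
have a0 k : 0 < a k by rewrite invr_gt0.
pose S k j := [set w | ULE_const (a k) (j.+1%:R : R) (V w)].
pose A k : set (g_sigma_algebraType (@open Omega)) := \bigcup_j S k j.
have mA k : measurable (A k).
  apply: bigcup_measurable => j _; apply: closed_measurable.
  exact: closed_ULE_const.
have TA k i : T i @^-1` A k = A k.
  apply/seteqP; split => w [j _ wj]; exists j => //.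
    (* Applying [T i] translates the potential by [unitv i]; translating back recovers that of
       [w]. *)
    have := ULE_const_shift (- unitv i) (a0 k) (ltr0Sn R j) wj.
    by rewrite /S /=; under eq_fun do rewrite VT subrK.
  rewrite /S /= (_ : V (T i w) = fun n => V w (n + unitv i)); last exact/funext.
  exact: ULE_const_shift.
have aeA : {ae mu, forall w, (\bigcup_k A k) w}.
  apply: (negligibleS _ hULE) => w; apply: contra_not => -[al [al0 [C [C0 HC]]]].
  (* With these indices [1 / (k + 1) <= al] and [C <= j + 1]. *)
  exists (Num.truncn al^-1) => //; exists (Num.truncn C) => //.
  apply: (ULE_const_le _ (ltW C0) _ HC); last exact/ltW/truncnS_gt.
  by rewrite /a invf_ple ?posrE // ltW // truncnS_gt.
have [k Ak] := ae_bigcup_invariant herg mA TA aeA.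
exists (a k); split=> //; apply: (negligibleS _ Ak) => w; apply: contra_not => -[j _ wj].
by exists j.+1%:R; split.
Qed.
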